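(* There exist uncountably many isomorphism types of three-generated subgroups $\langle g_1,g_2,g_3\rangle$ of $\mathrm{Homeo}^+(I)$ such that the squares $g_1^2,g_2^2,g_3^2$ of the generators generate a cyclic group. Moreover, there exists a three-generated subgroup $\langle g_1,g_2,g_3\rangle$ of $\mathrm{Homeo}^+(I)$ such that the squares of the generators generate a cyclic group and which contains a nonabelian free group.
   Context: $I=[0,1]$ and $\mathrm{Homeo}^+(I)$ is the group of orientation-preserving homeomorphisms of $I$. *)

(* Defs.v *)
From HB Require Import structures.
From mathcomp Require Import all_boot all_order all_algebra.
From mathcomp Require Import all_classical all_reals topology normedtype.
Import Order.TTheory GRing.Theory Num.Theory.
Import numFieldNormedType.Exports.

Set Implicit Arguments.
Unset Strict Implicit.
Unset Printing Implicit Defensive.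

Local Open Scope classical_set_scope.

(* [groupType] allows infinite groups, unlike [finGroupType], but the library
   has no subgroup theory for it: subgroups are handled as classical sets. *)
Section Subgroups.
Local Open Scope group_scope.
Variable G : groupType.
Implicit Types (A B H K : set G) (w : seq (G * bool)).

Definition is_subgroup H : Prop := group_closed (mem H).

Definition generated A : set G := smallest is_subgroup A.

Definition is_cyclic H : Prop := exists c : G, H = generated [set c].

(* The letter (x, false) stands for x, and (x, true) for x^-1. *)
Definition word_value w : G :=
  \prod_(p <- w) (if p.2 then p.1^-1 else p.1).

Definition reduced_word B w : Prop :=
  (forall p, p \in w -> B p.1) /\ sorted (fun p q => q != (p.1, ~~ p.2)) w.

Definition free_basis B H : Prop :=
  B `<=` H /\
  forall x, H x -> exists! w, reduced_word B w /\ word_value w = x.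

Definition is_free H : Prop := is_subgroup H /\ exists B, free_basis B H.

Definition is_abelian H : Prop := forall x y, H x -> H y -> commute x y.

Definition contains_nonabelian_free H : Prop :=
  exists K, [/\ K `<=` H, is_free K & ~ is_abelian K].

Definition three_generated_cyclic_squares H : Prop :=
  exists g1 g2 g3 : G,
    H = generated [set g1; g2; g3] /\
    is_cyclic (generated [set g1 ^+ 2; g2 ^+ 2; g3 ^+ 2]).

End Subgroups.

(* The map f only matters on H: it is a total function G -> G' because
   subgroups are sets rather than types. *)
Definition isomorphic (G G' : groupType) (H : set G) (K : set G') : Prop :=
  exists f : G -> G',
    (forall x y, H x -> H y -> f (x * y)%g = (f x * f y)%g) /\ set_bij H K f.

Definition isomorphism_type (G : groupType) (H : set G) : set (set G) :=
  [set K | is_subgroup K /\ isomorphic H K].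

Definition homeomorphism (X Y : topologicalType) (f : X -> Y) : Prop :=
  continuous f /\
  exists g : Y -> X, [/\ cancel f g, cancel g f & continuous g].

Section HomeoPlus.
Local Open Scope ring_scope.
Variable R : realType.

(* A subtype with the subspace topology, via the coercion [set_type]. *)
Definition unit_interval : set R := `[0, 1]%classic.

Definition orientation_preserving (f : unit_interval -> unit_interval) : Prop :=
  forall x y, \val x < \val y -> \val (f x) < \val (f y).

Record homeo_plus := HomeoPlus {
  homeo_fun :> unit_interval -> unit_interval ;
  homeo_funP : homeomorphism homeo_fun /\ orientation_preserving homeo_fun }.

Lemma homeo_plus_eq (f g : homeo_plus) : homeo_fun f = homeo_fun g -> f = g.
Proof.
case: f g => [f fP] [g gP] /= fg; case: _ / fg gP => gP.
by congr HomeoPlus; exact: Prop_irrelevance.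
Qed.

HB.instance Definition _ := gen_eqMixin homeo_plus.
HB.instance Definition _ := gen_choiceMixin homeo_plus.

Lemma homeo_idP :
  homeomorphism (@idfun unit_interval) /\ orientation_preserving idfun.
Proof.
have cid : continuous (@idfun unit_interval) by move=> x; exact: cvg_id.
by split=> //; split=> //; exists idfun; split.
Qed.

Lemma homeo_compP (f g : homeo_plus) :
  homeomorphism (f \o g) /\ orientation_preserving (f \o g).
Proof.
case: f g => [f [[cf [f' [fK f'K cf']]] of_]] [g [[cg [g' [gK g'K cg']]] og]].
split=> /=; last by move=> x y xy; apply/of_/og.
split; first by move=> x; apply: continuous_comp; [exact: cg|exact: cf].
exists (g' \o f'); split; [exact: can_comp|exact: can_comp|].
by move=> x; apply: continuous_comp; [exact: cf'|exact: cg'].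
Qed.

Lemma homeo_inv_subproof (f : homeo_plus) :
  exists g : homeo_plus, cancel f g /\ cancel g f.
Proof.
case: f => [f [[cf [f' [fK f'K cf']]] of_]] /=.
have f'P : homeomorphism f' /\ orientation_preserving f'.
  split; first by split=> //; exists f.
  move=> x y xy; rewrite ltNge; apply/negP; rewrite le_eqVlt => /orP[/eqP/val_inj|].
    by move=> /(can_inj f'K) yx; rewrite yx ltxx in xy.
  by move=> /of_; rewrite !f'K ltNge (ltW xy).
by exists (HomeoPlus f'P).
Qed.

Definition homeo_id : homeo_plus := HomeoPlus homeo_idP.
Definition homeo_comp (f g : homeo_plus) : homeo_plus :=
  HomeoPlus (homeo_compP f g).
Definition homeo_inv (f : homeo_plus) : homeo_plus :=
  projT1 (cid (homeo_inv_subproof f)).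

Lemma homeo_compA : associative homeo_comp.
Proof. by move=> f g h; exact: homeo_plus_eq. Qed.

Lemma homeo_comp1f : left_id homeo_id homeo_comp.
Proof. by move=> f; exact: homeo_plus_eq. Qed.

Lemma homeo_compf1 : right_id homeo_id homeo_comp.
Proof. by move=> f; exact: homeo_plus_eq. Qed.

Lemma homeo_compVf : left_inverse homeo_id homeo_inv homeo_comp.
Proof.
move=> f; apply/homeo_plus_eq/funext => x /=; rewrite /homeo_inv.
by case: cid => g [/= fK _]; exact: fK.
Qed.

Lemma homeo_compfV : right_inverse homeo_id homeo_inv homeo_comp.
Proof.
move=> f; apply/homeo_plus_eq/funext => x /=; rewrite /homeo_inv.
by case: cid => g [/= _ gK]; exact: gK.
Qed.

HB.instance Definition _ := isGroup.Build homeo_plus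
  homeo_compA homeo_comp1f homeo_compf1 homeo_compVf homeo_compfV.

End HomeoPlus.

Arguments unit_interval : clear implicits.

(* Main.v *)
Require Import Defs.
From mathcomp Require Import all_boot all_order all_algebra.
From mathcomp Require Import all_classical all_reals.
From mathcomp Require Import topology normedtype realfun ereal ring lra.

(* Identify the open interval with the line. For a family f : Z -> Homeo+(I), let
   F f act on each [n, n + 1] as a copy of f n, and let T be the translation by 1;
   then F is an injective morphism and F f ^ T is F of the shifted family.

   Given X and Y, let x = F (X, X^-1, X, ...) and y = F (Y, Y^-1, Y, ...), with
   alternating signs. As x ^ T = x^-1, we get (T x)^2 = T^2, and likewise for y, so
   the squares of T, T x, T y generate <T^2>, whereas x and y lie in <T, T x, T y>.

   If X and Y freely generate a group, so do x and y; such X and Y are obtained by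
   ping-pong on four periodic families of intervals.

   If a and b do not commute, put X = T and Y = F f, where f 0 = a, f (k + 1) = b
   for k in S, and f n = 1 elsewhere. Then Y commutes with Y ^ (X^(k+1)) if and
   only if k is not in S, and the same holds for x and y. Hence S can be read off
   the isomorphism type of <T, T x, T y> and a pair of its elements. As this group
   is countable, each isomorphism type comes from countably many S. *)

Set Implicit Arguments.
Unset Strict Implicit.
Unset Printing Implicit Defensive.
Import Order.TTheory GRing.Theory Num.Theory numFieldNormedType.Exports.
Local Open Scope classical_set_scope.

(** * Subgroups generated by a set *)

Section GroupTheory.
Local Open Scope group_scope.
Variable G : groupType.
Implicit Types (A H : set G) (x y : G).

Lemma is_subgroupP H :
  is_subgroup H <-> H 1 /\ forall x y, H x -> H y -> H (x / y).
Proof.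
split=> -[H1 HB]; split.
- by move: H1; rewrite -topredE /= in_setE.
- by move=> x y /mem_set Hx /mem_set Hy; apply: set_mem; exact: HB.
- by rewrite -topredE /= in_setE.
- by move=> x y /set_mem Hx /set_mem Hy; apply: mem_set; exact: HB.
Qed.

Lemma subgroup1 H : is_subgroup H -> H 1.
Proof. by case/is_subgroupP. Qed.

Lemma subgroupV H x : is_subgroup H -> H x -> H x^-1.
Proof. by case/is_subgroupP=> H1 HB Hx; rewrite -div1g; exact: HB. Qed.

Lemma subgroupM H x y : is_subgroup H -> H x -> H y -> H (x * y).
Proof.
move=> sH Hx /(subgroupV sH) Hy; rewrite -[y]invgK.
by case/is_subgroupP: sH => _; apply.
Qed.

Lemma subgroupX H x n : is_subgroup H -> H x -> H (x ^+ n).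
Proof.
move=> sH Hx; elim: n => [|n IHn]; first exact: subgroup1.
by rewrite expgS; exact: subgroupM.
Qed.

Lemma subgroupJ H x y : is_subgroup H -> H x -> H y -> H (x ^ y).
Proof.
by move=> sH Hx Hy; rewrite conjgE; do !apply: (subgroupM sH) => //; exact: subgroupV sH Hy.
Qed.

Lemma generated_subgroup A : is_subgroup (generated A).
Proof.
apply/is_subgroupP; split; first by move=> H [/subgroup1].
move=> x y Ax Ay H HA; have [/is_subgroupP[_ +] _] := HA.
by apply; [exact: Ax | exact: Ay].
Qed.

Lemma sub_generated A : A `<=` generated A.
Proof. exact: sub_gen_smallest. Qed.

Lemma generated_sub A H : is_subgroup H -> A `<=` H -> generated A `<=` H.
Proof. exact: smallest_sub. Qed.

(** * Words in an indexed family, and free generation *)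

Section Words.
Variables (I : eqType) (t : I -> G).
Implicit Types (p : I * bool) (w : seq (I * bool)).

Definition letter p : G := if p.2 then (t p.1)^-1 else t p.1.

Definition word_eval w : G := \prod_(p <- w) letter p.

Definition flip p : I * bool := (p.1, ~~ p.2).

Definition reduced w := sorted (fun p q => q != flip p) w.

Lemma letter_flip p : letter (flip p) = (letter p)^-1.
Proof. by rewrite /letter; case: p => i [] //=; rewrite invgK. Qed.

Lemma word_eval_cons p w : word_eval (p :: w) = letter p * word_eval w.
Proof. exact: big_cons. Qed.

Lemma word_evalV w : (word_eval w)^-1 = word_eval (rev (map flip w)).
Proof.
elim: w => [|p w IHw]; first by rewrite /word_eval !big_nil invg1.
rewrite word_eval_cons invgM IHw /= rev_cons /word_eval -cats1 big_cat /=.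
by rewrite big_seq1 letter_flip.
Qed.

Lemma generated_words : generated (range t) = range word_eval.
Proof.
apply/seteqP; split.
  apply: generated_sub; last first.
    by move=> _ [i _ <-]; exists [:: (i, false)] => //; rewrite /word_eval big_seq1.
  apply/is_subgroupP; split; first by exists [::] => //; rewrite /word_eval big_nil.
  move=> _ _ [u _ <-] [v _ <-]; exists (u ++ rev (map flip v)) => //.
  by rewrite word_evalV /word_eval big_cat.
move=> _ [w _ <-]; have sG := generated_subgroup (range t).
elim: w => [|p w IHw]; first by rewrite /word_eval big_nil; exact: subgroup1.
rewrite word_eval_cons; apply: (subgroupM sG) IHw.
have tp : generated (range t) (t p.1) by apply: sub_generated; exists p.1.
by rewrite /letter; case: ifP => _ //; exact: subgroupV sG tp.
Qed.

(** A letter put before a reduced word either keeps it reduced or cancels its head, and the tail of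
    a reduced word is reduced. *)
Lemma reduced_word_eval w : exists2 v, reduced v & word_eval v = word_eval w.
Proof.
elim: w => [|p w [v rv vw]]; first by exists [::].
case: v rv vw => [|q v] rv vw.
  by exists [:: p] => //; rewrite !word_eval_cons vw.
have [qp|qp] := eqVneq q (flip p); last first.
  by exists [:: p, q & v]; rewrite ?word_eval_cons -?vw ?word_eval_cons //= qp.
exists v; first exact: path_sorted rv.
by rewrite word_eval_cons -vw word_eval_cons qp letter_flip mulVKg.
Qed.

(** Words are spelled in indices, so injectivity of [t] is a consequence, not an assumption. *)
Definition freely_generating :=
  forall u v, reduced u -> reduced v -> word_eval u = word_eval v -> u = v.

Hypothesis free_t : freely_generating.

Lemma freely_generating_inj : injective t.
Proof.
move=> i j tij; have := @free_t [:: (i, false)] [:: (j, false)] isT isT.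
by rewrite /word_eval !big_seq1 => /(_ tij) [].
Qed.

Lemma freely_generating_is_free : is_free (generated (range t)).
Proof.
split; first exact: generated_subgroup.
exists (range t); split; first exact: sub_generated.
(* [up] turns index words into words over group elements; being injective, it preserves and reflects
   reducedness. *)
pose up p := (t p.1, p.2).
have up_inj : injective up.
  by case=> i a [j b] [/freely_generating_inj -> ->].
have upE w : word_value (map up w) = word_eval w by rewrite /word_value big_map.
have redE w : sorted (fun a b => b != (a.1, ~~ a.2)) (map up w) = reduced w.
  rewrite sorted_map /reduced; suff E : relpre up (fun a b => b != (a.1, ~~ a.2))
      =2 (fun p q => q != flip p) by rewrite (path.eq_sorted E).
  by move=> p q /=; rewrite -[(t p.1, _)]/(up (flip p)) (inj_eq up_inj).
move=> x; rewrite generated_words => -[w _ <-].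
have [v rv <-] := reduced_word_eval w; exists (map up v); split.
  rewrite upE; split=> //; split; last by rewrite redE.
  by move=> _ /mapP[p _ ->]; exists p.1.
move=> s [[sB rs] sv].
have [u su] : exists u, s = map up u.
  elim: s sB {rs sv} => [|[g b] s IHs] sB; first by exists [::].
  have [|u ->] := IHs; first by move=> p ps; apply: sB; rewrite inE ps orbT.
  have [i _ /= ti] := sB (g, b) (mem_head _ _).
  by exists ((i, b) :: u); rewrite /= /up /= ti.
by move: sv rs; rewrite su upE redE => sv rs; rewrite (free_t rs rv sv).
Qed.

Lemma freely_generating_noncommuting i j : i != j -> ~ commute (t i) (t j).
Proof.
move=> ij cij.
have rij k l : reduced [:: (k, false); (l, false)].
  by rewrite /reduced /= /flip xpair_eqE andbF.
have /(free_t (rij i j) (rij j i)) : word_eval [:: (i, false); (j, false)] =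
    word_eval [:: (j, false); (i, false)].
  by rewrite /word_eval !big_cons !big_nil !mulg1.
by case=> ji; rewrite ji eqxx in ij.
Qed.

End Words.

Lemma countable_generated (I : countType) (t : I -> G) :
  countable (generated (range t)).
Proof.
by rewrite generated_words; exact: sub_countable (card_image_le _ _) (countableP _).
Qed.

Lemma range_triple (g1 g2 g3 : G) :
  range (oapp (fun b : bool => if b then g1 else g2) g3) = [set g1; g2; g3].
Proof.
apply/seteqP; split=> [_ [[[]|] _ <-]|z [[]|] ->] /=.
- by left; left.
- by left; right.
- by right.
- by exists (Some true).
- by exists (Some false).
- by exists None.
Qed.

End GroupTheory.

(** * The ping-pong lemma for two generators *)

Section PingPong.
Local Open Scope group_scope.
Variables (G : groupType) (U : Type) (act : G -> U -> U).
Hypothesis act1 : forall u, act 1 u = u.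
Hypothesis actM : forall g h u, act (g * h) u = act g (act h u).
Variables (t : bool -> G) (Q : bool * bool -> set U).
Hypothesis Q0 : forall p, Q p !=set0.
Hypothesis Q_disj : forall p q u, Q p u -> Q q u -> p = q.
Hypothesis Q_act : forall p q u, q != flip p -> Q q u -> Q p (act (letter t p) u).

(** The last letter acts first; since the word is reduced, each letter then receives a point outside
    the region of its inverse. *)
Lemma ping_pong_word p w q u : reduced (p :: w) -> q != flip (last p w) ->
  Q q u -> Q p (act (word_eval t (p :: w)) u).
Proof.
elim: w p => [|p' w IHw] p rw qw Qu; rewrite word_eval_cons actM.
  by rewrite /word_eval big_nil act1; exact: Q_act qw Qu.
have /andP[p'p rw'] := rw.
by apply: Q_act p'p _; exact: IHw.
Qed.

(* Four letters, so two forbidden ones leave a possible starting region. *)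
Lemma avoid_two (p q : bool * bool) : exists r, r != p /\ r != q.
Proof.
case: p q => [[] []] [[] []];
  do [by exists (true, true) | by exists (true, false) | by exists (false, true)
     | by exists (false, false)].
Qed.

Lemma ping_pong : freely_generating t.
Proof.
have nil_cons p w : reduced (p :: w) -> word_eval t (p :: w) <> 1.
  move=> rw w1; have [q [qw qp]] := avoid_two (flip (last p w)) p.
  have [u Qu] := Q0 q; have := ping_pong_word rw qw Qu.
  by rewrite w1 act1 => /(Q_disj Qu) qp'; rewrite qp' eqxx in qp.
elim=> [|p v IHv] [|q w] // rv rw.
- by rewrite {1}/word_eval big_nil => /esym /nil_cons; case.
- by rewrite {2}/word_eval big_nil => /nil_cons; case.
have [<-|pq] := eqVneq p q.
  rewrite !word_eval_cons => /mulgI vw; congr (_ :: _).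
  exact: IHv (path_sorted rv) (path_sorted rw) vw.
(* The first letters differ, so a start admissible for both words would be sent into two disjoint
   regions. *)
move=> vw; have [r [rlv rlw]] := avoid_two (flip (last p v)) (flip (last q w)).
have [u Qu] := Q0 r; have := ping_pong_word rv rlv Qu.
rewrite vw => /(Q_disj (ping_pong_word rw rlw Qu)) qp.
by rewrite qp eqxx in pq.
Qed.

End PingPong.

(** * Transport of commutation along isomorphisms of subgroups *)

Section IsomorphicCommutation.
Local Open Scope group_scope.
Variables (G G' : groupType) (H : set G) (f : G -> G').
Hypothesis sH : is_subgroup H.
Hypothesis fM : forall x y, H x -> H y -> f (x * y) = f x * f y.
Hypothesis f_inj : set_inj H f.

Lemma subgroup_morph1 : f 1 = 1.
Proof.
have H1 := subgroup1 sH.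
by apply: (mulgI (f 1)); rewrite -fM // !mulg1.
Qed.

Lemma subgroup_morphV x : H x -> f x^-1 = (f x)^-1.
Proof.
move=> Hx; apply: (mulgI (f x)); rewrite -fM ?mulgV ?subgroup_morph1 //.
exact: subgroupV.
Qed.

Lemma subgroup_morphX x n : H x -> f (x ^+ n) = f x ^+ n.
Proof.
move=> Hx; elim: n => [|n IHn]; first exact: subgroup_morph1.
by rewrite !expgS fM ?IHn //; exact: subgroupX.
Qed.

Lemma subgroup_morphJ x y : H x -> H y -> f (x ^ y) = f x ^ f y.
Proof.
move=> Hx Hy; rewrite !conjgE.
have HV := subgroupV sH Hy; have HM := subgroupM sH Hx Hy.
by rewrite !fM ?subgroup_morphV.
Qed.

Lemma subgroup_morph_commute x y : H x -> H y ->
  commute (f x) (f y) <-> commute x y.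
Proof.
move=> Hx Hy; have HM := subgroupM sH Hx Hy; have HM' := subgroupM sH Hy Hx.
rewrite /commute -!fM //; split=> [fxy|-> //].
by apply: f_inj fxy; exact/mem_set.
Qed.

End IsomorphicCommutation.

(** * Square roots of a squared shift in a wreath product *)

Section IntegerWreath.
Local Open Scope group_scope.
(* F and T together embed the unrestricted wreath product of G by Z into G. *)
Variables (G : groupType) (F : (int -> G) -> G) (T : G).
Hypothesis F_mul : forall f g, F (fun n => f n * g n) = F f * F g.
Hypothesis F_inj : injective F.
Hypothesis F_shift : forall f, F f ^ T = F (fun n => f (n + 1)%R).
Implicit Types (x y : G) (n : int).

Lemma F_one : F (fun=> 1) = 1.
Proof.
apply: (mulgI (F (fun=> 1))); rewrite mulg1 -F_mul; congr F.
by apply/funext => n; rewrite mulg1.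
Qed.

Lemma F_inv f : F (fun n => (f n)^-1) = (F f)^-1.
Proof.
apply: (mulgI (F f)); rewrite -F_mul mulgV -F_one; congr F.
by apply/funext => n; rewrite mulgV.
Qed.

Lemma F_exp f k : F (fun n => f n ^+ k) = F f ^+ k.
Proof.
elim: k => [|k IHk]; first exact: F_one.
rewrite expgS -IHk -F_mul; congr F.
by apply/funext => n; rewrite expgS.
Qed.

Lemma F_conj f g : F (fun n => f n ^ g n) = F f ^ F g.
Proof. by rewrite conjgE -F_inv -!F_mul. Qed.

Lemma F_commute f g : commute (F f) (F g) <-> forall n, commute (f n) (g n).
Proof.
rewrite /commute -!F_mul; split=> [/F_inj fg n|fg]; first by move/(congr1 (@^~ n)): fg.
by congr F; apply/funext.
Qed.

Lemma F_shiftX f k : F f ^ (T ^+ k) = F (fun n => f (n + k%:Z)%R).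
Proof.
elim: k f => [|k IHk] f.
  by rewrite conjg1; congr F; apply/funext => n; rewrite addr0.
rewrite expgS conjgM F_shift IHk; congr F; apply/funext => n.
by rewrite -addrA -[k.+1]addn1 PoszD.
Qed.

Definition alt n x : G := if odd `|n| then x^-1 else x.

Definition alternating x : G := F (alt^~ x).

Lemma alternating_shift x : alternating x ^ T = (alternating x)^-1.
Proof.
rewrite F_shift -F_inv; congr F; apply/funext => n; rewrite /alt.
have -> : odd `|(n + 1)%R| = ~~ odd `|n|.
  case: n => n; first by rewrite -PoszD addn1.
  (* For negative [n] the absolute value drops by one, which also switches the parity. *)
  by rewrite [RHS]/= negbK NegzE intS opprD addrAC addNr add0r abszN.
by case: odd; rewrite ?invgK.
Qed.

(** With x the alternating element, x T = T x^-1, so T x T x = T T x^-1 x. *)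
Lemma alternating_square x : (T * alternating x) ^+ 2 = T ^+ 2.
Proof.
rewrite !expgS expg0 !mulg1.
have : T^-1 * (alternating x * T) = (alternating x)^-1.
  by rewrite -conjgE alternating_shift.
move=> /(canRL (mulVKg T)) xT.
by rewrite mulgA -(mulgA T) xT -!mulgA mulVg mulg1.
Qed.

Definition square_root_group x y : set G :=
  generated [set T; T * alternating x; T * alternating y].

Lemma square_root_groupP x y :
  three_generated_cyclic_squares (square_root_group x y).
Proof.
exists T, (T * alternating x), (T * alternating y); split=> //.
by exists (T ^+ 2); rewrite !alternating_square !setUid.
Qed.

Lemma square_root_group_mem x y :
  square_root_group x y (alternating x) /\ square_root_group x y (alternating y).
Proof.
have sH : is_subgroup (square_root_group x y) := generated_subgroup _.
have HT : square_root_group x y T by apply: sub_generated; left; left.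
have TH z : square_root_group x y (T * z) -> square_root_group x y z.
  move=> HTz; rewrite -(mulKg T z).
  exact: subgroupM sH (subgroupV sH HT) HTz.
by split; apply: TH; apply: sub_generated; [left; right | right].
Qed.

Lemma alternating_word (I : eqType) (t : I -> G) w :
  word_eval (fun i => alternating (t i)) w =
  F (fun n => word_eval (fun i => alt n (t i)) w).
Proof.
elim: w => [|p w IHw].
  by rewrite /word_eval big_nil -[LHS]F_one; congr F; apply/funext => n; rewrite big_nil.
rewrite word_eval_cons IHw.
have -> : letter (fun i => alternating (t i)) p =
    F (fun n => letter (fun i => alt n (t i)) p).
  by rewrite /letter; case: ifP => // _; rewrite F_inv.
by rewrite -F_mul; congr F; apply/funext => n; rewrite word_eval_cons.
Qed.

Lemma alternating_freely_generating (I : eqType) (t : I -> G) :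
  freely_generating t -> freely_generating (fun i => alternating (t i)).
Proof.
(* At coordinate 0 the sign is positive and the original family is recovered. *)
move=> ft u v ru rv; rewrite !alternating_word => /F_inj /(congr1 (@^~ 0%R)).
exact: ft.
Qed.

Lemma square_root_group_free (t : bool -> G) : freely_generating t ->
  contains_nonabelian_free (square_root_group (t true) (t false)).
Proof.
move=> /alternating_freely_generating ft.
exists (generated (range (fun b => alternating (t b)))); split.
- apply: generated_sub; first exact: generated_subgroup.
  have [Hx Hy] := square_root_group_mem (t true) (t false).
  by move=> _ [[] _ <-].
- exact: freely_generating_is_free.
- move/(_ (alternating (t true)) (alternating (t false))) => ab.
  apply: (@freely_generating_noncommuting _ _ _ ft true false) => //.
  by apply: ab; apply: sub_generated; [exists true | exists false].
Qed.

(** Even coordinates repeat the condition on [x] and [y]. Odd ones ask that y^-1 commute with its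
    conjugate by x^-k; inverting and conjugating by x^k gives the same condition. *)
Lemma alternating_commute x y k :
  commute (alternating y) (alternating y ^ (alternating x ^+ k)) <->
  commute y (y ^ (x ^+ k)).
Proof.
rewrite -F_exp -F_conj F_commute; split=> [/(_ 0%R)//|cyx n].
rewrite /alt; case: ifP => // _.
rewrite conjVg; apply: commuteV; apply: commute_sym; apply: commuteV.
have : (y ^ (x^-1 ^+ k)) ^ (x ^+ k) = y by rewrite -conjgM expVgn mulVg conjg1.
move: (y ^ (x^-1 ^+ k)) => z zy.
apply: (conjg_inj (x ^+ k)); rewrite [LHS]conjMg [RHS]conjMg zy.
exact: cyx.
Qed.

(** * Encoding sets of natural numbers in isomorphism types *)

Variables (a b : G).
Hypothesis ab : ~ commute a b.

(* Conjugating by T ^+ k.+1 moves the b coded at position k.+1 onto the a at 0,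
   and no other position can then obstruct commutation. *)
Definition coding (S : set nat) : G :=
  F (fun n => match n with
    | Posz 0 => a
    | Posz k.+1 => if k \in S then b else 1
    | Negz _ => 1
    end).

Lemma coding_commute S k :
  commute (coding S) (coding S ^ (T ^+ k.+1)) <-> ~ S k.
Proof.
rewrite F_shiftX F_commute; split=> [/(_ 0%R) /=|nSk n].
  by case: ifPn => [_ //|/negP nSk _ Sk]; apply: nSk; exact: mem_set.
(* At negative coordinates the left entry is 1; at positive ones both entries are [b] or 1. *)
case: n => [[|n]|n]; last exact: commute_sym (commute1 _).
  by rewrite add0r; case: ifPn => [/set_mem//|_]; exact: commute1.
rewrite -PoszD addSn; case: ifP => _; case: ifP => _ //; first exact: commute1.
by apply: commute_sym; exact: commute1.
Qed.

Definition decoding x y : set nat :=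
  [set k | ~ commute y (y ^ (x ^+ k.+1))].

Definition coded_group S := square_root_group T (coding S).

(** Take preimages of the alternating copies of [T] and [coding S]: an isomorphism preserves the
    commutation pattern that spells out [S]. *)
Lemma coded_group_decoding S H : is_subgroup H -> isomorphic H (coded_group S) ->
  exists x y, [/\ H x, H y & S = decoding x y].
Proof.
move=> sH [f [fM [_ f_inj f_surj]]].
have [Hx Hy] := square_root_group_mem T (coding S).
have [x Hx' fx] := f_surj _ Hx; have [y Hy' fy] := f_surj _ Hy.
have E k : commute y (y ^ (x ^+ k.+1)) <-> ~ S k.
  have HX := subgroupX k.+1 sH Hx'.
  apply: iff_trans (iff_sym (subgroup_morph_commute sH fM f_inj Hy'
    (subgroupJ sH Hy' HX))) _.
  rewrite (subgroup_morphJ sH fM) // (subgroup_morphX sH fM) // fx fy.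
  exact: iff_trans (alternating_commute _ _ _) (coding_commute _ _).
exists x, y; split=> //; apply/seteqP; split=> k.
  by move=> Sk /E.
by move=> nc; apply: contrapT => /E.
Qed.

Lemma uncountable_coded_groups :
  ~ countable [set isomorphism_type H | H in
      [set H : set G | three_generated_cyclic_squares H]].
Proof.
set C := (X in countable X) => countC.
have countS : countable [set: set nat].
  (* Each fibre of the map from [S] to the type of its coded group is countable: all its members are
     decoded from pairs in one countable representative [K]. *)
  have : countable (\bigcup_(c in C)
      [set S | isomorphism_type (coded_group S) = c]).
    apply: bigcup_countable => // _ [H [g1 [g2 [g3 [-> _]]]] <-].
    set K := generated _.
    have countK : countable K by rewrite /K -range_triple; exact: countable_generated.
    apply: (@sub_countable _ _ _ ((fun p => decoding p.1 p.2) @` (K `*` K))).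
      apply: subset_card_le => S /= SK.
      have [x [y [Kx Ky ->]]] : exists x y, [/\ K x, K y & S = decoding x y].
        apply: coded_group_decoding; first exact: generated_subgroup.
        (* The coded group lies in its own type, hence in that of [K]. *)
        have : isomorphism_type (coded_group S) (coded_group S).
          split; first exact: generated_subgroup.
          exists id; split=> //; split=> [x|x y _ _|x Hx] //; first by exists x.
        by rewrite SK => -[].
      by exists (x, y).
    apply: sub_countable (card_image_le _ _) _.
    exact: countableX.
  apply: sub_countable; apply: subset_card_le => S _.
  exists (isomorphism_type (coded_group S)) => //.
  by exists (coded_group S) => //; exact: square_root_groupP.
have /countable_injP[f /(_ _ _ (in_setT _) (in_setT _)) f_inj] := countS.
(* Cantor's diagonal set for the injection [f]. *)
pose D := [set n | exists S, f S = n /\ ~ S n].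
have : ~ D (f D) by move=> /[dup] DD [S [/f_inj ->]]; exact.
by move=> nD; apply: (nD); exists D.
Qed.

End IntegerWreath.

(** * Increasing bijections of the unit interval *)

Section IntervalHomeomorphisms.
Local Open Scope ring_scope.
Variable R : realType.
Notation U := (unit_interval R).
Notation G := (homeo_plus R).
Implicit Types (u v : U) (r : R) (x : \bar R).

Lemma unit_interval_itv u : 0 <= \val u <= 1.
Proof. by have := set_valP u; rewrite /unit_interval /= in_itv. Qed.

Lemma unit_interval0 : (0 : R) \in unit_interval R.
Proof. by rewrite inE /unit_interval /= in_itv /= lexx ler01. Qed.

(** Reals outside the interval go to the default value 0. *)
Definition toU r : U := insubd (exist _ 0 unit_interval0 : U) r.

Lemma toUK r : 0 <= r <= 1 -> \val (toU r) = r.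
Proof. by move=> r01; rewrite insubdK // inE /unit_interval /= in_itv. Qed.

Lemma valUK u : toU (\val u) = u.
Proof. exact: valKd. Qed.

Lemma increasing_mono (f : U -> U) : orientation_preserving f ->
  forall u v, (\val (f u) <= \val (f v)) = (\val u <= \val v).
Proof.
move=> incf u v; case: (ltgtP (\val u) (\val v)) => [/incf/ltW //|/incf|/val_inj ->].
  by rewrite ltNge => /negbTE.
exact: lexx.
Qed.

(** An increasing map onto a segment has no jumps; the right inverse [g] supplies surjectivity. *)
Lemma increasing_bij_continuous (f g : U -> U) :
  orientation_preserving f -> cancel g f -> continuous f.
Proof.
move=> incf gK; apply: continuous_comp_initial.
pose h r := \val (f (toU r)).
have -> : set_val \o f = sigL (unit_interval R) h.
  by apply/funext => u; rewrite /sigL /h /= valUK.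
apply/subspace_sigL_continuousP/segment_inc_surj_continuous.
  move=> a b; rewrite !in_itv /= => a01 b01.
  by rewrite /h increasing_mono // !toUK.
move=> b; rewrite /= in_itv /= => /andP[b0 b1].
have b01 : 0 <= b <= 1.
  rewrite (le_trans _ b0) ?(le_trans b1) //.
    by have /andP[] := unit_interval_itv (f (toU 1)).
  by have /andP[] := unit_interval_itv (f (toU 0)).
exists (\val (g (toU b))); last by rewrite /h valUK gK toUK.
by rewrite in_itv /=; exact: unit_interval_itv.
Qed.

Lemma increasing_bij_homeo_plus (f g : U -> U) :
  orientation_preserving f -> cancel f g -> cancel g f ->
  exists h : G, homeo_fun h = f.
Proof.
move=> incf fK gK.
have incg : orientation_preserving g.
  by move=> u v uv; rewrite ltNge -(increasing_mono incf) !gK -ltNge.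
suff fP : homeomorphism f /\ orientation_preserving f by exists (HomeoPlus fP).
split=> //; split; first exact: increasing_bij_continuous incf gK.
by exists g; split=> //; exact: increasing_bij_continuous incg fK.
Qed.

(** * The interval as the extended line: [contract] maps it onto [-1, 1], rescaled to [0, 1] *)

Definition ofE x : U := toU ((contract x + 1) / 2).

Lemma val_ofE x : \val (ofE x) = (contract x + 1) / 2.
Proof.
have := contract_le1 x; rewrite ler_norml => /andP[x0 x1].
by rewrite toUK //; apply/andP; split; lra.
Qed.

Definition toE u : \bar R := expand (2 * \val u - 1).

Lemma ofEK : cancel ofE toE.
Proof.
move=> x; rewrite /toE val_ofE mulrCA divff // mulr1 addrK; exact: contractK.
Qed.

Lemma toEK : cancel toE ofE.
Proof.
move=> u; apply/val_inj; rewrite val_ofE /toE expandK; first by lra.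
by rewrite inE ler_norml; have /andP[] := unit_interval_itv u; lra.
Qed.

Lemma ofE_lt x y : (\val (ofE x) < \val (ofE y)) = (x < y)%O.
Proof. by rewrite !val_ofE ltr_pM2r ?invr_gt0 // ltrD2r lt_contract. Qed.

(* Junk (the identity) unless [l] is an increasing bijection. *)
Definition line_homeo (l : R -> R) : G :=
  xget 1%g [set g : G | forall x, g (ofE x) = ofE (er_map l x)].

Lemma line_homeoE (l m : R -> R) : {homo l : r s / r < s} ->
  cancel l m -> cancel m l -> forall x, line_homeo l (ofE x) = ofE (er_map l x).
Proof.
move=> incl lK mK; rewrite /line_homeo; case: xgetP => [g _ //|none].
(* [er_map] fixes both infinities, so the conjugate of [l] extends to the endpoints. *)
have [||| g gE] := @increasing_bij_homeo_plus
  (fun u => ofE (er_map l (toE u))) (fun u => ofE (er_map m (toE u))).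
- move=> u v; rewrite -{1}(toEK u) -{1}(toEK v) !ofE_lt.
  case: (toE u) (toE v) => [r| |] [s| |] //=; rewrite ?ltNyr ?ltry //.
  by rewrite !lte_fin; exact: incl.
- by move=> u; rewrite ofEK -{2}(toEK u); case: (toE u) => //= r; rewrite lK.
- by move=> u; rewrite ofEK -{2}(toEK u); case: (toE u) => //= r; rewrite mK.
by case: (none g) => x; rewrite gE ofEK.
Qed.

Definition pt r : U := ofE r%:E.

Lemma pt_inj : injective pt.
Proof. by move=> r s /(can_inj ofEK) []. Qed.

Lemma homeo_mulE (g h : G) u : (g * h)%g u = g (h u).
Proof. by []. Qed.

Lemma homeoK (g : G) : cancel g (g^-1)%g.
Proof. by move=> u; rewrite -homeo_mulE mulVg. Qed.

Lemma homeo_le (g : G) u v : (\val (g u) <= \val (g v)) = (\val u <= \val v).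
Proof. by case: g => g [hg incg]; exact: increasing_mono. Qed.

Lemma homeo_lt (g : G) u v : (\val (g u) < \val (g v)) = (\val u < \val v).
Proof. by rewrite !ltNge homeo_le. Qed.

Lemma homeo_lt1 (g : G) u : \val u < 1 -> \val (g u) < 1.
Proof.
move=> u1; have /andP[_] := unit_interval_itv (g (toU 1)).
by apply: lt_le_trans; rewrite homeo_lt toUK ?ler01 ?lexx.
Qed.

Lemma homeo1 (g : G) u : \val u = 1 -> \val (g u) = 1.
Proof.
move=> u1; have /andP[_] := unit_interval_itv (g u).
rewrite le_eqVlt => /orP[/eqP //|/(homeo_lt1 g^-1%g)].
by rewrite homeoK u1 ltxx.
Qed.

(** * Pasting homeomorphisms on the unit cells of the line *)

Definition frac r : R := r - (Num.floor r)%:~R.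

Lemma frac_itv r : 0 <= frac r < 1.
Proof.
have := floor_itv r; rewrite /frac intrD => /andP[r0 r1].
by apply/andP; split; lra.
Qed.

Lemma floorDfrac (n : int) r : 0 <= r < 1 -> Num.floor (n%:~R + r) = n.
Proof.
move=> /andP[r0 r1]; apply: floor_def; rewrite intrD.
by apply/andP; split; lra.
Qed.

Lemma fracDint (n : int) r : 0 <= r < 1 -> frac (n%:~R + r) = r.
Proof. by move=> r01; rewrite /frac floorDfrac // addrC addKr. Qed.

Lemma toU_frac r : \val (toU (frac r)) = frac r.
Proof. by have /andP[r0 /ltW r1] := frac_itv r; rewrite toUK // r0. Qed.

Lemma homeo_frac (g : G) r : 0 <= \val (g (toU (frac r))) < 1.
Proof.
have /andP[-> _] := unit_interval_itv (g (toU (frac r))).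
by rewrite homeo_lt1 // toU_frac; have /andP[] := frac_itv r.
Qed.

(** Half-open cells [n, n + 1) suffice, because every element of the group preserves [0, 1). *)
Definition paste (f : int -> G) r : R :=
  (Num.floor r)%:~R + \val (f (Num.floor r) (toU (frac r))).

Lemma floor_paste f r : Num.floor (paste f r) = Num.floor r.
Proof. exact: floorDfrac (homeo_frac _ _). Qed.

Lemma frac_paste f r : frac (paste f r) = \val (f (Num.floor r) (toU (frac r))).
Proof. exact: fracDint (homeo_frac _ _). Qed.

Lemma paste_comp f g r : paste f (paste g r) = paste (fun n => f n * g n)%g r.
Proof. by rewrite {1}/paste floor_paste frac_paste valUK. Qed.

Lemma paste1 r : paste (fun=> 1%g) r = r.
Proof. by rewrite /paste [X in \val X]/= toU_frac addrC subrK. Qed.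

Lemma paste_lt f : {homo paste f : r s / r < s}.
Proof.
move=> r s rs; have [rs_floor|] := ltP (Num.floor r) (Num.floor s).
  (* Points of different cells keep their cells, hence their order. *)
  have /andP[_ fr] := homeo_frac (f (Num.floor r)) r.
  have /andP[fs _] := homeo_frac (f (Num.floor s)) s.
  have : (Num.floor r)%:~R + 1 <= (Num.floor s)%:~R :> R.
    by rewrite -(intrD _ _ 1) ler_int lezD1.
  rewrite /paste; lra.
rewrite le_eqVlt => /orP[/eqP E|]; last first.
  by rewrite ltNge le_floor // ltW.
by rewrite /paste E ltrD2l homeo_lt !toU_frac /frac E ltrD2r.
Qed.

Lemma pasteK f : cancel (paste f) (paste (fun n => (f n)^-1)%g).
Proof.
move=> r; rewrite paste_comp -[RHS]paste1; congr (paste _ r).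
by apply/funext => n; rewrite mulVg.
Qed.

Lemma pasteVK f : cancel (paste (fun n => (f n)^-1)%g) (paste f).
Proof.
move=> r; rewrite paste_comp -[RHS]paste1; congr (paste _ r).
by apply/funext => n; rewrite mulgV.
Qed.

Definition paste_homeo f : G := line_homeo (paste f).

Definition translation (c : R) : G := line_homeo (fun r => r + c).

Lemma paste_homeoE f x : paste_homeo f (ofE x) = ofE (er_map (paste f) x).
Proof. exact: line_homeoE (@paste_lt f) (pasteK f) (pasteVK f) x. Qed.

Lemma translationE c x : translation c (ofE x) = ofE (er_map (fun r => r + c) x).
Proof.
apply: (@line_homeoE _ (fun r => r - c)) => [r s||]; first by rewrite ltrD2r.
  exact: addrK.
exact: subrK.
Qed.

Lemma translationVE c r : (translation c)^-1%g (pt r) = pt (r - c).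
Proof.
rewrite -[RHS](homeoK (translation c)); congr ((translation c)^-1%g _).
by rewrite /pt translationE /= subrK.
Qed.

Lemma homeo_ofE_eq (g h : G) : (forall x, g (ofE x) = h (ofE x)) -> g = h.
Proof.
move=> gh; apply/homeo_plus_eq/funext => u.
by rewrite -(toEK u).
Qed.

Lemma paste_homeoM f g :
  paste_homeo (fun n => f n * g n)%g = (paste_homeo f * paste_homeo g)%g.
Proof.
apply: homeo_ofE_eq => x; rewrite homeo_mulE !paste_homeoE.
by case: x => //= r; rewrite paste_comp.
Qed.

Lemma paste_homeo_inj : injective paste_homeo.
Proof.
move=> f g fg; apply/funext => n; apply/homeo_plus_eq/funext => u; apply/val_inj.
have /andP[u0] := unit_interval_itv u.
(* The endpoint 1 is no fractional part, but every element fixes it; any other [u] is seen at the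
   point n + u. *)
rewrite le_eqVlt => /orP[/eqP u1|u1]; first by rewrite !homeo1.
have u01 : 0 <= \val u < 1 by rewrite u0.
have /pt_inj : pt (paste f (n%:~R + \val u)) = pt (paste g (n%:~R + \val u)).
  by rewrite -[LHS](paste_homeoE f _%:E) -[RHS](paste_homeoE g _%:E) fg.
by rewrite /paste floorDfrac // fracDint // valUK => /addrI.
Qed.

(** The right factor acts first: cell n is moved to cell n + 1, acted on there by the map of index n
    + 1, and moved back. *)
Lemma paste_homeo_shift f :
  (paste_homeo f ^ translation 1)%g = paste_homeo (fun n => f (n + 1)).
Proof.
rewrite conjgE; apply: (mulgI (translation 1)); rewrite mulVKg.
apply: homeo_ofE_eq => x; rewrite !homeo_mulE !(translationE, paste_homeoE).
case: x => //= r; congr (ofE _%:E).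
have E : Num.floor (r + 1) = Num.floor r + 1.
  apply: floor_def; rewrite !intrD lerD2r ltrD2r -(intrD _ _ 1).
  exact: floor_itv.
by rewrite /paste /frac E intrD opprD addrACA subrr addr0 addrAC.
Qed.

(** * A free pair of homeomorphisms, by ping-pong on the circle *)

Definition circle_coord (b : bool) r : R := if b then frac r else frac (r + 2^-1).

(* The attracting regions of the four letters of [free_pair]: they partition the
   open interval, as the two circle coordinates differ by half a turn. *)
Definition quarter (p : bool * bool) : set U :=
  [set u | exists2 r, u = pt r &
    if p.2 then circle_coord p.1 r < 4^-1 else 3 / 4 <= circle_coord p.1 r].

(* The number 2 is chosen so that the translation sends the point 1/4 = pt (-1)
   of the unit interval to 3/4 = pt 1. *)
Definition push : G := paste_homeo (fun=> translation 2).

(** The second generator is [push] seen in the coordinate rotated by half a turn. *)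
Definition free_pair (b : bool) : G :=
  if b then push else (push ^ translation 2^-1)%g.

Lemma frac_half r :
  frac (r + 2^-1) = if frac r < 2^-1 then frac r + 2^-1 else frac r - 2^-1.
Proof.
have /andP[r0 r1] := frac_itv r; case: ifPn => [r2|]; last rewrite -leNgt => r2.
  have -> : r + 2^-1 = (Num.floor r)%:~R + (frac r + 2^-1) by rewrite /frac; lra.
  by rewrite fracDint //; apply/andP; split; lra.
have -> : r + 2^-1 = (Num.floor r + 1)%:~R + (frac r - 2^-1).
  by rewrite intrD /frac; lra.
by rewrite fracDint //; apply/andP; split; lra.
Qed.

(** In terms of [frac r], the regions of (true, true), (false, false), (false, true), (true, false)
    are the successive quarters of [0, 1). *)
Lemma quarter_disj p q u : quarter p u -> quarter q u -> p = q.
Proof.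
case: p q => [[] []] [[] []] [r -> /= rp] [s /pt_inj <- /= rq] //; exfalso;
  move: rp rq; rewrite /circle_coord ?frac_half; have /andP[] := frac_itv r;
  do [lra | case: ifP; lra].
Qed.

Lemma quarter0 p : quarter p !=set0.
Proof.
suff [r Hr] : exists r, if p.2 then circle_coord p.1 r < 4^-1
    else 3 / 4 <= circle_coord p.1 r by exists (pt r), r.
have F (s : R) : 0 <= s < 1 -> frac s = s.
  by move=> s01; rewrite -{1}[s]add0r (fracDint 0).
(* The witnesses are the left ends of the four quarters. *)
case: p => [[] []] /=; [exists 0|exists (3/4)|exists (2^-1)|exists (4^-1)];
  rewrite /circle_coord ?frac_half F; (try by apply/andP; split; lra);
  do [lra | case: ifP; lra].
Qed.

Lemma val_ofE_N1 : \val (ofE (-1)%:E : U) = 4^-1.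
Proof. by rewrite val_ofE /= normrN1; field. Qed.

Lemma val_ofE_1 : \val (ofE 1%:E : U) = 3 / 4.
Proof. by rewrite val_ofE /= normr1; field. Qed.

Lemma translation2 : translation 2 (pt (-1)) = pt 1.
Proof. by rewrite [LHS]translationE; congr (ofE _%:E); lra. Qed.

(** On each cell [push] is a copy of an increasing map taking 1/4 to 3/4. *)
Lemma push_quarter r : 4^-1 <= frac r ->
  exists2 s, push (pt r) = pt s & 3 / 4 <= frac s.
Proof.
move=> r4; exists (paste (fun=> translation 2) r); first exact: paste_homeoE.
rewrite frac_paste -val_ofE_1 -[ofE _]translation2 homeo_le toU_frac.
by rewrite val_ofE_N1.
Qed.

Lemma pushV_quarter r : frac r < 3 / 4 ->
  exists2 s, (push^-1)%g (pt r) = pt s & frac s < 4^-1.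
Proof.
move=> r4; exists (paste (fun=> (translation 2)^-1)%g r).
  rewrite -[RHS](homeoK push); congr ((push^-1)%g _).
  rewrite [RHS]paste_homeoE /=; congr (ofE _%:E); rewrite paste_comp.
  by rewrite -[LHS]paste1; congr (paste _ r); apply/funext => n; rewrite mulgV.
rewrite frac_paste -val_ofE_N1 -[ofE _](homeoK (translation 2)) translation2.
by rewrite homeo_lt toU_frac val_ofE_1.
Qed.

Lemma free_pair_quarter p q u : q != flip p -> quarter q u ->
  quarter p (letter free_pair p u).
Proof.
(* Being outside the region of the inverse letter is exactly the bound on the circle coordinate
   required to push. *)
move=> qp Qu; have nQ : ~ quarter (flip p) u.
  by move=> /(quarter_disj Qu) E; rewrite E eqxx in qp.
have [r ur _] := Qu; rewrite {}ur {q qp Qu} in nQ *.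
have transE s : translation 2^-1 (pt s) = pt (s + 2^-1) by exact: translationE.
case: p nQ => [[] []] nQ; rewrite /letter /=.
- have [|s -> s4] := @pushV_quarter r; last by exists s.
  by rewrite ltNge; apply/negP => r4; apply: nQ; exists r.
- have [|s -> s4] := @push_quarter r; last by exists s.
  by rewrite leNgt; apply/negP => r4; apply: nQ; exists r.
- have [|s sE s4] := @pushV_quarter (r + 2^-1).
    by rewrite ltNge; apply/negP => r4; apply: nQ; exists r.
  rewrite -conjVg conjgE !homeo_mulE transE sE translationVE.
  by exists (s - 2^-1); rewrite // /circle_coord /= subrK.
- have [|s sE s4] := @push_quarter (r + 2^-1).
    by rewrite leNgt; apply/negP => r4; apply: nQ; exists r.
  rewrite transE sE translationVE.
  by exists (s - 2^-1); rewrite // /circle_coord /= subrK.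
Qed.

Lemma free_pair_free : freely_generating free_pair.
Proof.
apply: (@ping_pong _ _ (fun g : G => homeo_fun g) _ _ _ quarter).
- by [].
- by [].
- exact: quarter0.
- exact: quarter_disj.
- exact: free_pair_quarter.
Qed.

End IntervalHomeomorphisms.

Theorem corollary1p13 (R : realType) :
  ~ countable
      [set isomorphism_type H | H in
         [set H : set (homeo_plus R) | three_generated_cyclic_squares H]] /\
  exists H : set (homeo_plus R),
    three_generated_cyclic_squares H /\ contains_nonabelian_free H.
Proof.
have free := @free_pair_free R.
have M := @paste_homeoM R; have inj := @paste_homeo_inj R.
have shift := @paste_homeo_shift R; split.
  (* The free pair also serves as the noncommuting pair of the coding. *)
  apply: (uncountable_coded_groups M inj shift).
  exact: (freely_generating_noncommuting free (isT : true != false)).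
exists (square_root_group (@paste_homeo R) (translation 1)
  (free_pair R true) (free_pair R false)); split.
  exact: square_root_groupP.
exact: square_root_group_free.
Qed.
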